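(* For every $n\geq 6$, the $n$-dimensional torus $T^n$ admits a Riemannian metric whose second Gauss–Bonnet curvature $h_4$ is constant and positive.
   Context: For a Riemannian manifold of dimension $n\ge 4$ with Riemann tensor $R$, Ricci tensor $Ric$ and scalar curvature $Scal$, the second Gauss–Bonnet curvature is the function $h_4=|R|^2-|Ric|^2+\frac14 Scal^2$, where in an orthonormal basis $|R|^2=\sum_{i<j,\,k<l}R_{ijkl}^2=\frac14\sum_{i,j,k,l}R_{ijkl}^2$ and $|Ric|^2=\sum_{i,j}Ric_{ij}^2$. *)

(* Defs.v *)
From HB Require Import structures.
From mathcomp Require Import all_boot all_order all_algebra.
From mathcomp Require Import all_classical all_reals all_analysis.
Set Implicit Arguments.
Unset Strict Implicit.
Unset Printing Implicit Defensive.
Import Order.TTheory GRing.Theory Num.Theory.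
Import numFieldNormedType.Exports.
Local Open Scope ring_scope.

(** The torus is T^n = R^n / Z^n.  Pulling back along the covering R^n -> T^n
    identifies smooth functions on T^n with smooth Z^n-periodic functions on
    R^n.  The coordinate fields d/dx^i descend to a global frame of the tangent
    bundle of T^n, so a Riemannian metric on T^n is the same thing as a smooth,
    Z^n-periodic map from R^n to the symmetric positive definite matrices. *)

Section Smooth.
Variables (R : realType) (n : nat).

Definition partial (i : 'I_n) (f : 'rV[R]_n -> R) : 'rV[R]_n -> R :=
  fun x => 'D_('e_i) f x.

Fixpoint classC (k : nat) (f : 'rV[R]_n -> R) : Prop :=
  continuous f /\
  (if k is k'.+1 then
     forall i, (forall x, derivable f x 'e_i) /\ classC k' (partial i f)
   else True).

Definition smooth (f : 'rV[R]_n -> R) : Prop := forall k, classC k f.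

End Smooth.

Section TorusMetric.
Variables (R : realType) (n : nat).

Definition positive_definite (G : 'M[R]_n) : Prop :=
  forall v : 'rV[R]_n, v != 0 -> 0 < (v *m G *m v^T) 0 0.

Record torus_metric (g : 'rV[R]_n -> 'M[R]_n) : Prop := TorusMetric {
  metric_smooth : forall i j, smooth (fun x => g x i j);
  metric_periodic : forall (x : 'rV[R]_n) (z : 'rV[int]_n),
    g (x + map_mx intr z) = g x;
  metric_sym : forall x, (g x)^T = g x;
  metric_posdef : forall x, positive_definite (g x)
}.

End TorusMetric.

Section Curvature.
Variables (R : realType) (n : nat) (g : 'rV[R]_n -> 'M[R]_n).

Definition dmetric (l i j : 'I_n) : 'rV[R]_n -> R :=
  partial l (fun y => g y i j).

(** Gamma^k_{ij} of the Levi-Civita connection. *)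
Definition christoffel (k i j : 'I_n) : 'rV[R]_n -> R := fun x =>
  2^-1 * \sum_l invmx (g x) k l *
           (dmetric i j l x + dmetric j i l x - dmetric l i j x).

(** R^i_{jkl}, where R(d_k, d_l) d_j = \sum_i R^i_{jkl} d_i and
    R(X, Y) = [nabla_X, nabla_Y] - nabla_[X, Y]. *)
Definition riemann_up (i j k l : 'I_n) : 'rV[R]_n -> R := fun x =>
  partial k (christoffel i l j) x - partial l (christoffel i k j) x
  + \sum_m (christoffel i k m x * christoffel m l j x
            - christoffel i l m x * christoffel m k j x).

Definition riemann (i j k l : 'I_n) : 'rV[R]_n -> R := fun x =>
  \sum_m g x i m * riemann_up m j k l x.

Definition ricci (j l : 'I_n) : 'rV[R]_n -> R := fun x =>
  \sum_i riemann_up i j i l x.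

Definition scal : 'rV[R]_n -> R := fun x =>
  \sum_i \sum_j invmx (g x) i j * ricci i j x.

(** The rows of e are the coordinates, in the basis d/dx^i, of the vectors
    e_0, ..., e_(n-1) of a basis of the tangent space. *)
Definition orthonormal_basis (x : 'rV[R]_n) (e : 'M[R]_n) : Prop :=
  e *m g x *m e^T = 1%:M.

Definition riemann_in (x : 'rV[R]_n) (e : 'M[R]_n) (i j k l : 'I_n) : R :=
  \sum_a \sum_b \sum_c \sum_d
    e i a * e j b * e k c * e l d * riemann a b c d x.

Definition ricci_in (x : 'rV[R]_n) (e : 'M[R]_n) (i j : 'I_n) : R :=
  \sum_a \sum_b e i a * e j b * ricci a b x.

(** |R|^2 is the norm of R as a double form: each index pair is summed over
    i < j only. *)
Definition riemann_norm2 (x : 'rV[R]_n) (e : 'M[R]_n) : R :=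
  \sum_(i < n) \sum_(j < n | (i < j)%N) \sum_(k < n) \sum_(l < n | (k < l)%N)
    riemann_in x e i j k l ^+ 2.

Definition ricci_norm2 (x : 'rV[R]_n) (e : 'M[R]_n) : R :=
  \sum_i \sum_j ricci_in x e i j ^+ 2.

(** h_4 at x, computed in the basis e; meaningful when e is orthonormal. *)
Definition h4 (x : 'rV[R]_n) (e : 'M[R]_n) : R :=
  riemann_norm2 x e - ricci_norm2 x e + 4^-1 * scal x ^+ 2.

End Curvature.

(** Every tangent space has an orthonormal basis, so quantifying universally
    over orthonormal bases is never vacuous. *)
Lemma orthonormal_basis_exists (R : realType) (n : nat) (g : 'rV[R]_n -> 'M[R]_n)
    (x : 'rV[R]_n) : torus_metric g -> exists e, orthonormal_basis g x e.
Proof.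
move=> gm; have := metric_sym gm x; have := metric_posdef gm x.
rewrite /orthonormal_basis; move: (g x) => G Gpos Gsym.
suff ext k : (k <= n)%N -> exists A : 'M[R]_(k, n), A *m G *m A^T = 1%:M.
  exact: ext.
elim: k => [|k IHk] kn; first by exists 0; apply/matrixP => -[].
have [A AG] := IHk (ltnW kn).
pose K := kermx (G *m A^T).
have K0 : K != 0.
  rewrite -mxrank_eq0 mxrank_ker subn_eq0 -ltnNge.
  exact: leq_ltn_trans (rank_leq_col _) kn.
have v0 := nz_row_eq0 K; set v := nz_row K in v0.
have vA : v *m G *m A^T = 0.
  by rewrite -mulmxA; apply/sub_kermxP; exact: nz_row_sub.
have q0 : 0 < (v *m G *m v^T) 0 0 by apply: Gpos; rewrite v0.
set q := (v *m G *m v^T) 0 0 in q0.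
pose w := (Num.sqrt q)^-1 *: v.
have wA : w *m G *m A^T = 0 by rewrite -!scalemxAl vA scaler0.
have Aw : A *m G *m w^T = 0.
  by apply: trmx_inj; rewrite !trmx_mul trmxK Gsym mulmxA wA trmx0.
have ww : w *m G *m w^T = 1%:M.
  rewrite linearZ /= -!scalemxAl -scalemxAr scalerA -invfM -expr2.
  rewrite sqr_sqrtr ?ltW// [v *m G *m v^T]mx11_scalar -/q scale_scalar_mx.
  by rewrite mulVf// gt_eqF.
rewrite -addn1; exists (col_mx A w).
by rewrite mul_col_mx tr_col_mx mul_col_row AG ww wA Aw -scalar_mx_block.
Qed.

(* Main.v *)
Require Import Defs.
From HB Require Import structures.
From mathcomp Require Import all_boot all_order all_algebra.
From mathcomp Require Import all_classical all_reals all_analysis.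
From mathcomp Require Import ring lra.
Import Order.TTheory GRing.Theory Num.Theory.
Import numFieldNormedType.Exports.
Local Open Scope ring_scope.

(** Scalar curvature is additive on Riemannian products, and so are |R|^2 and
    |Ric|^2; the only cross term of h_4 comes from the square of Scal:
      h_4(g1 + g2) = h_4(g1) + h_4(g2) + Scal(g1) Scal(g2) / 2
    ([gauss_bonnet_prod]).  In dimension 3, h_4 vanishes identically.  Hence
    if T^3 carries a metric of constant negative scalar curvature s, the
    product of two copies of it with the flat torus T^(n-6) has
    h_4 = s^2 / 2 > 0.

    Such a metric on T^3 can be written down.  On R^3 with coordinates (t, y, z)
    take dt^2 + G(t), where G(t) is a family of inner products on the (y, z)-plane
    with determinant 1:
      G(t) = 5/4 + 3/4 S(t),
      S(t) = [[cos wt, sin wt], [sin wt, - cos wt]],   w = 2 pi.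
    The slices are flat and have constant area, so the scalar curvature is
    - tr (A^2) with A = G^-1 G' / 2.  In the hyperbolic plane of inner products
    of determinant 1, G runs around a circle at constant speed, which makes
    this a negative constant, - 9/32 w^2 ([scal_twisted]).  The components
    R^i_jkl are trigonometric polynomials of degree at most one in t, and they
    are all computed; that h_4 vanishes is read off from the values of
    |R|^2, |Ric|^2 and Scal^2 ([gauss_bonnet_twisted]).

    To treat all orthonormal bases e at once, h_4 is first rewritten as a
    contraction of the curvature with the inverse metric ([h4_gauss_bonnet]),
    which is possible because the rows of e satisfy e^T e = g^-1. *)

(** * Contracting the curvature with the inverse metric *)

Section Contraction.
Set Implicit Arguments.
Unset Strict Implicit.
Variables (R : realType) (n : nat) (g : 'rV[R]_n -> 'M[R]_n).

(** The curvature endomorphism R(d_k, d_l) of the tangent space. *)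
Definition curv (k l : 'I_n) (x : 'rV[R]_n) : 'M[R]_n :=
  \matrix_(i, j) riemann_up g i j k l x.

Definition ricci_mx (x : 'rV[R]_n) : 'M[R]_n := \matrix_(j, l) ricci g j l x.

(** In an orthonormal basis, skewness of R in its first two indices gives
    sum_ij R_ijkl^2 = - tr (R(e_k, e_l)^2).  Summing over k and l by means of the
    inverse metric yields the sum of all R_ijkl^2, and |R|^2 is a quarter of it. *)
Definition curv_norm2 (x : 'rV[R]_n) : R :=
  - 4^-1 * \sum_k \sum_k' \sum_l \sum_l'
    invmx (g x) k k' * invmx (g x) l l' * \tr (curv k l x *m curv k' l' x).

Definition ricci_mx_norm2 (x : 'rV[R]_n) : R :=
  \tr (invmx (g x) *m ricci_mx x *m (invmx (g x) *m (ricci_mx x)^T)).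

Definition gauss_bonnet (x : 'rV[R]_n) : R :=
  curv_norm2 x - ricci_mx_norm2 x + 4^-1 * scal g x ^+ 2.

Definition skew_curv (x : 'rV[R]_n) : Prop :=
  forall k l, (g x *m curv k l x)^T = - (g x *m curv k l x).

Lemma curv_swap k l x : curv l k x = - curv k l x.
Proof.
apply/matrixP => i j; rewrite !mxE /riemann_up opprD opprB; congr (_ + _).
by rewrite -sumrN; apply: eq_bigr => m _; rewrite opprB.
Qed.

Lemma riemannE a b c d x : riemann g a b c d x = (g x *m curv c d x) a b.
Proof. by rewrite mxE; apply: eq_bigr => m _; rewrite mxE. Qed.

Lemma sum_lt_half (f : 'I_n -> 'I_n -> R) :
  (forall i j, f i j = f j i) -> (forall i, f i i = 0) ->
  \sum_(i < n) \sum_(j < n | (i < j)%N) f i j = 2^-1 * \sum_i \sum_j f i j.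
Proof.
move=> fC f0; suff -> : \sum_i \sum_j f i j =
    2 * \sum_(i < n) \sum_(j < n | (i < j)%N) f i j by field.
rewrite mulr_natl mulr2n.
rewrite [X in _ = _ + X](exchange_big_dep predT) //= -big_split.
apply: eq_bigr => i _ /=.
rewrite (bigID (fun j : 'I_n => (i < j)%N)) /=; congr (_ + _).
rewrite (bigID (fun j : 'I_n => i == j)) /= big1 ?add0r; last first.
  by move=> j /andP[_ /eqP <-].
apply: eq_big => [j|j _]; last exact: fC.
by rewrite -leqNgt ltn_neqAle eq_sym andbC.
Qed.

(** The rows of e are orthonormal, so e^T has the inverse e g. *)
Lemma orthonormal_inv x e : orthonormal_basis g x e ->
  e^T *m (e *m g x) = 1%:M /\ invmx (g x) = e^T *m e.
Proof.
rewrite /orthonormal_basis => /mulmx1C eG; split => //.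
rewrite mulmxA in eG; have [_ gu] := mulmx1_unit eG.
by rewrite -[RHS](mulmxK gu) eG mul1mx.
Qed.

(** Since e^T is inverse to e g, the components of the curvature in the basis e
    are, up to a change of basis by conjugation, those of the endomorphisms
    R(e_k, e_l). *)
Lemma riemann_inE x e i j k l : riemann_in g x e i j k l =
  (e *m g x *m (\sum_c \sum_d (e k c * e l d) *: curv c d x) *m e^T) i j.
Proof.
rewrite -[e *m g x *m _]mulmxA mulmx_sumr mulmx_sumr mulmx_suml summxE /riemann_in.
under [RHS]eq_bigr => c _ do rewrite mulmx_sumr mulmx_sumr mulmx_suml summxE.
under [LHS]eq_bigr => a _ do under eq_bigr => b _ do under eq_bigr => c _ do
  under eq_bigr => d _ do rewrite riemannE.
under [LHS]eq_bigr => a _ do rewrite exchange_big /=.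
rewrite exchange_big /=; apply: eq_bigr => c _.
under eq_bigr => a _ do (under eq_bigr => b _ do []; rewrite exchange_big /=).
rewrite exchange_big /=; apply: eq_bigr => d _.
rewrite mxE exchange_big /=; apply: eq_bigr => b _; rewrite !mxE mulr_suml.
apply: eq_bigr => a _; rewrite -scalemxAr [X in _ = _ * X * _]mxE; ring.
Qed.

Lemma ricci_inE x e : \matrix_(i, j) ricci_in g x e i j = e *m ricci_mx x *m e^T.
Proof.
apply/matrixP => i j; rewrite !mxE /ricci_in exchange_big; apply: eq_bigr => b _ /=.
by rewrite !mxE mulr_suml; apply: eq_bigr => a _; rewrite mxE; ring.
Qed.

Lemma sqr_norm_mx (X : 'M[R]_n) : \sum_i \sum_j X i j ^+ 2 = \tr (X *m X^T).
Proof.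
by apply: eq_bigr => i _; rewrite mxE; apply: eq_bigr => j _; rewrite mxE expr2.
Qed.

(** With X k l the matrix of R(e_k, e_l) in the basis e, skewness turns the sum
    over i < j, k < l into a quarter of the full sum, and the sum over i, j into
    - tr (X k l)^2, which is invariant under conjugation; the sums over k, l
    then produce the factors e^T e = g^-1. *)
Lemma riemann_norm2E x e : skew_curv x -> orthonormal_basis g x e ->
  riemann_norm2 g x e = curv_norm2 x.
Proof.
move=> skew eo; have [eG Pe] := orthonormal_inv eo.
pose D k l : 'M[R]_n := \sum_c \sum_d (e k c * e l d) *: curv c d x.
pose X k l := e *m g x *m D k l *m e^T.
have XT k l : (X k l)^T = - X k l.
  rewrite /X -[e *m _ *m _]mulmxA trmx_mul trmxK [(e *m _)^T]trmx_mul mulmxA.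
  rewrite -mulNmx -mulmxN.
  congr (_ *m _ *m _); rewrite /D !mulmx_sumr raddf_sum -sumrN.
  apply: eq_bigr => c _ /=; rewrite !mulmx_sumr raddf_sum -sumrN.
  by apply: eq_bigr => d _ /=; rewrite -scalemxAr linearZ /= skew scalerN.
have Xij k l i j : X k l j i = - X k l i j.
  by have /matrixP/(_ i j) := XT k l; rewrite !mxE.
have DC k l : D l k = - D k l.
  rewrite /D exchange_big -sumrN; apply: eq_bigr => c _ /=.
  by rewrite -sumrN; apply: eq_bigr => d _; rewrite curv_swap scalerN mulrC.
have XC k l : X l k = - X k l by rewrite /X DC mulmxN mulNmx.
have zero (a : R) : a = - a -> a = 0 by lra.
have Xkk k i j : X k k i j = 0 by apply: zero; rewrite {1}XC mxE.
have Xii k l i : X k l i i = 0 by apply: zero; rewrite {1}Xij.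
rewrite /riemann_norm2.
under eq_bigr => i _ do under eq_bigr => j _ do under eq_bigr => k _ do
  under eq_bigr => l _ do rewrite riemann_inE -/(D k l) -/(X k l).
have half i j : \sum_(k < n) \sum_(l < n | (k < l)%N) X k l i j ^+ 2 =
    2^-1 * \sum_k \sum_l X k l i j ^+ 2.
  apply: sum_lt_half => [k l|k]; first by rewrite XC mxE sqrrN.
  by rewrite Xkk expr0n.
under eq_bigr => i _ do under eq_bigr => j _ do rewrite half.
rewrite sum_lt_half; last 2 first.
- move=> i j; congr (_ * _); apply: eq_bigr => k _; apply: eq_bigr => l _.
  by rewrite Xij sqrrN.
- move=> i; rewrite big1 ?mulr0 // => k _; rewrite big1 // => l _.
  by rewrite Xii expr0n.
under eq_bigr => i _ do rewrite -mulr_sumr.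
rewrite -mulr_sumr mulrA /curv_norm2 mulNr -mulrN; congr (_ * _); first by field.
under eq_bigr => i _ do rewrite exchange_big /=.
rewrite exchange_big /=.
under eq_bigr => k _ do (under eq_bigr => i _ do rewrite exchange_big /=).
under eq_bigr => k _ do rewrite exchange_big /=.
have trX k l : \sum_i \sum_j X k l i j ^+ 2 = - \tr (D k l *m D k l).
  rewrite sqr_norm_mx XT mulmxN raddfN /=; congr (- _); rewrite /X.
  rewrite -[e *m g x *m _ *m _ *m _]mulmxA [LHS]mxtrace_mulC !mulmxA.
  rewrite -[e^T *m e *m _]mulmxA eG mul1mx -[D k l *m e^T *m e]mulmxA.
  by rewrite -[D k l *m _ *m g x]mulmxA -[e^T *m e *m _]mulmxA eG mulmx1.
under eq_bigr => k _ do under eq_bigr => l _ do rewrite trX.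
have trD k l : \tr (D k l *m D k l) = \sum_c \sum_c' \sum_d \sum_d'
    (e k c * e k c') * (e l d * e l d') * \tr (curv c d x *m curv c' d' x).
  rewrite {1}/D mulmx_suml raddf_sum; apply: eq_bigr => c _ /=.
  rewrite mulmx_suml raddf_sum [RHS]exchange_big; apply: eq_bigr => d _ /=.
  rewrite mulmx_sumr raddf_sum; apply: eq_bigr => c' _ /=.
  rewrite mulmx_sumr raddf_sum; apply: eq_bigr => d' _ /=.
  by rewrite -scalemxAl -scalemxAr !mxtraceZ; ring.
under eq_bigr => k _ do (under eq_bigr => l _ do rewrite trD; rewrite sumrN).
rewrite sumrN; congr (- _).
(* The sums over the basis indices k, l move inside those over the coordinates. *)
under [LHS]eq_bigr => k _ do rewrite exchange_big /=.
rewrite [LHS]exchange_big /=; apply: eq_bigr => c _.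
under [LHS]eq_bigr => k _ do rewrite exchange_big /=.
rewrite [LHS]exchange_big /=; apply: eq_bigr => c' _.
under [LHS]eq_bigr => k _ do rewrite exchange_big /=.
rewrite [LHS]exchange_big /=; apply: eq_bigr => d _.
under [LHS]eq_bigr => k _ do rewrite exchange_big /=.
rewrite [LHS]exchange_big /=; apply: eq_bigr => d' _.
under eq_bigr => k _ do rewrite -mulr_suml -mulr_sumr.
rewrite -!mulr_suml Pe; congr (_ * _ * _); rewrite mxE; apply: eq_bigr => k _;
  by rewrite mxE.
Qed.

Lemma h4_gauss_bonnet x e :
  skew_curv x -> orthonormal_basis g x e -> h4 g x e = gauss_bonnet x.
Proof.
move=> skew eo; have [_ Pe] := orthonormal_inv eo.
rewrite /h4 /gauss_bonnet riemann_norm2E //; congr (_ - _ + _).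
rewrite /ricci_norm2 /ricci_mx_norm2.
under eq_bigr => i _ do under eq_bigr => j _ do
  rewrite -[ricci_in _ _ _ _ _](mxE matrix_key (fun i j => ricci_in g x e i j)).
rewrite sqr_norm_mx ricci_inE !trmx_mul trmxK Pe.
by rewrite !mulmxA [LHS]mxtrace_mulC !mulmxA.
Qed.

Lemma scal_tr x : scal g x = \tr (invmx (g x) *m (ricci_mx x)^T).
Proof.
by apply: eq_bigr => i _; rewrite mxE; apply: eq_bigr => j _; rewrite !mxE.
Qed.

End Contraction.

(** * Derivatives along linear maps *)

Lemma classC_cst (R : realType) n k (c : R) : classC k (fun _ : 'rV[R]_n => c).
Proof.
elim: k c => [|k IHk] c; split=> //=; try exact: cst_continuous.
move=> i; split=> [x|]; first exact: (@derivable_cst _ _ _ c).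
have -> : partial i (fun _ : 'rV[R]_n => c) = fun=> 0.
  by apply/funext => y; exact: (@derive_cst _ _ _ c).
exact: IHk.
Qed.

Section LinearComposition.
Set Implicit Arguments.
Unset Strict Implicit.
Variables (R : realType) (V W : normedModType R) (L : V -> W).
Hypothesis L_lin : linear L.

Let quotientE (f : W -> R) x v :
  (fun h : R => h^-1 *: (((fun y => f (L y)) \o shift x) (h *: v) - f (L x))) =
  (fun h : R => h^-1 *: ((f \o shift (L x)) (h *: L v) - f (L x))).
Proof. by apply/funext => h /=; rewrite L_lin. Qed.

(** The difference quotients of the two sides are the same function. *)
Lemma derive_comp_linear (f : W -> R) x v :
  'D_v (fun y => f (L y)) x = 'D_(L v) f (L x).
Proof. by rewrite /derive quotientE. Qed.

Lemma derivable_comp_linear (f : W -> R) x v :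
  derivable f (L x) (L v) -> derivable (fun y => f (L y)) x v.
Proof. by rewrite /derivable quotientE. Qed.

End LinearComposition.

(** The condition on basis vectors holds for coordinate projections; it makes
    each partial derivative of f o L either zero or a partial derivative of f
    composed with L, so that the induction on the order closes. *)
Lemma smooth_comp_linear (R : realType) n m (L : 'rV[R]_n -> 'rV[R]_m)
    (f : 'rV[R]_m -> R) :
  linear L -> continuous L -> (forall i, L 'e_i = 0 \/ exists j, L 'e_i = 'e_j) ->
  smooth f -> smooth (fun y => f (L y)).
Proof.
move=> Ll Lc Le fs k; move: f {fs}(fs k); elim: k => [|k IHk] f [fc /= fk].
  by split=> //= x; apply: continuous_comp; [exact: Lc|exact: fc].
split=> [x|i]; first by apply: continuous_comp; [exact: Lc|exact: fc].
have -> : partial i (fun y => f (L y)) = fun y => 'D_(L 'e_i) f (L y).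
  by apply/funext => y; rewrite /partial (derive_comp_linear Ll).
have [Li|[j Li]] := Le i.
  split=> [x|].
    by apply: derivable_comp_linear => //; rewrite Li; exact: derivable0.
  rewrite Li; have -> : (fun y => 'D_0 f (L y)) = (fun=> 0).
    by apply/funext => y; rewrite derive0.
  exact: (@classC_cst R n k 0).
split=> [x|].
  by apply: derivable_comp_linear => //; rewrite Li; case: (fk j).
by rewrite Li; apply: (IHk (partial j f)); case: (fk j).
Qed.

(** * Riemannian products *)

Section Product.
Set Implicit Arguments.
Unset Strict Implicit.
Variables (R : realType) (n1 n2 : nat).
Variables (g1 : 'rV[R]_n1 -> 'M[R]_n1) (g2 : 'rV[R]_n2 -> 'M[R]_n2).

Definition prod_metric (x : 'rV[R]_(n1 + n2)) : 'M[R]_(n1 + n2) :=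
  block_mx (g1 (lsubmx x)) 0 0 (g2 (rsubmx x)).

(** The tensor on the product that is f1 on the first factor, f2 on the second
    one, and zero on mixed indices. *)
Definition split3 (f1 : 'I_n1 -> 'I_n1 -> 'I_n1 -> 'rV[R]_n1 -> R)
    (f2 : 'I_n2 -> 'I_n2 -> 'I_n2 -> 'rV[R]_n2 -> R) (i j k : 'I_(n1 + n2))
    (x : 'rV[R]_(n1 + n2)) : R :=
  match fintype.split i, fintype.split j, fintype.split k with
  | inl i', inl j', inl k' => f1 i' j' k' (lsubmx x)
  | inr i', inr j', inr k' => f2 i' j' k' (rsubmx x)
  | _, _, _ => 0
  end.

Definition split4 (f1 : 'I_n1 -> 'I_n1 -> 'I_n1 -> 'I_n1 -> 'rV[R]_n1 -> R)
    (f2 : 'I_n2 -> 'I_n2 -> 'I_n2 -> 'I_n2 -> 'rV[R]_n2 -> R)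
    (i j k l : 'I_(n1 + n2)) (x : 'rV[R]_(n1 + n2)) : R :=
  match fintype.split i, fintype.split j, fintype.split k, fintype.split l with
  | inl i', inl j', inl k', inl l' => f1 i' j' k' l' (lsubmx x)
  | inr i', inr j', inr k', inr l' => f2 i' j' k' l' (rsubmx x)
  | _, _, _, _ => 0
  end.

Lemma lsubmx_e_l i : lsubmx ('e_(lshift n2 i) : 'rV[R]_(n1 + n2)) = 'e_i.
Proof. by apply/rowP => j; rewrite !mxE eqxx (inj_eq (@lshift_inj _ _)). Qed.

Lemma rsubmx_e_l i : rsubmx ('e_(lshift n2 i) : 'rV[R]_(n1 + n2)) = 0.
Proof. by apply/rowP => j; rewrite !mxE eqxx eq_rlshift. Qed.

Lemma lsubmx_e_r i : lsubmx ('e_(rshift n1 i) : 'rV[R]_(n1 + n2)) = 0.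
Proof. by apply/rowP => j; rewrite !mxE eqxx eq_lrshift. Qed.

Lemma rsubmx_e_r i : rsubmx ('e_(rshift n1 i) : 'rV[R]_(n1 + n2)) = 'e_i.
Proof. by apply/rowP => j; rewrite !mxE eqxx (inj_eq (@rshift_inj _ _)). Qed.

Lemma partial_ll i (f : 'rV[R]_n1 -> R) (x : 'rV[R]_(n1 + n2)) :
  partial (lshift n2 i) (fun y => f (lsubmx y)) x = partial i f (lsubmx x).
Proof. by rewrite /partial (derive_comp_linear (linearP _)) /= lsubmx_e_l. Qed.

Lemma partial_rl i (f : 'rV[R]_n1 -> R) (x : 'rV[R]_(n1 + n2)) :
  partial (rshift n1 i) (fun y => f (lsubmx y)) x = 0.
Proof.
by rewrite /partial (derive_comp_linear (linearP _)) /= lsubmx_e_r derive0.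
Qed.

Lemma partial_lr i (f : 'rV[R]_n2 -> R) (x : 'rV[R]_(n1 + n2)) :
  partial (lshift n2 i) (fun y => f (rsubmx y)) x = 0.
Proof.
by rewrite /partial (derive_comp_linear (linearP _)) /= rsubmx_e_l derive0.
Qed.

Lemma partial_rr i (f : 'rV[R]_n2 -> R) (x : 'rV[R]_(n1 + n2)) :
  partial (rshift n1 i) (fun y => f (rsubmx y)) x = partial i f (rsubmx x).
Proof. by rewrite /partial (derive_comp_linear (linearP _)) /= rsubmx_e_r. Qed.

Lemma partial_cst m i (c : R) (x : 'rV[R]_m) : partial i (fun=> c) x = 0.
Proof. exact: (@derive_cst _ _ _ c). Qed.

Definition partialE := (partial_ll, partial_rl, partial_lr, partial_rr).

Lemma split_l i : fintype.split (lshift n2 i : 'I_(n1 + n2)) = inl i.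
Proof. exact: (unsplitK (inl i)). Qed.

Lemma split_r i : fintype.split (rshift n1 i : 'I_(n1 + n2)) = inr i.
Proof. exact: (unsplitK (inr i)). Qed.

Lemma prod_metricE j k x : prod_metric x j k =
  match fintype.split j, fintype.split k with
  | inl j', inl k' => g1 (lsubmx x) j' k'
  | inr j', inr k' => g2 (rsubmx x) j' k'
  | _, _ => 0
  end.
Proof.
case: (split_ordP j) => j' ->; case: (split_ordP k) => k' ->;
  rewrite ?split_l ?split_r.
- exact: block_mxEul.
- by rewrite [LHS]block_mxEur mxE.
- by rewrite [LHS]block_mxEdl mxE.
- exact: block_mxEdr.
Qed.

Lemma dmetric_prod i j k x :
  dmetric prod_metric i j k x = split3 (dmetric g1) (dmetric g2) i j k x.
Proof.
rewrite /split3 /dmetric (funext (prod_metricE j k)).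
case: (split_ordP i) => i' iE; case: (split_ordP j) => j' jE;
  case: (split_ordP k) => k' kE; rewrite ?iE ?partial_cst //.
- exact: (partial_ll i' (fun y => g1 y j' k')).
- exact: (partial_lr i' (fun y => g2 y j' k')).
- exact: (partial_rl i' (fun y => g1 y j' k')).
- exact: (partial_rr i' (fun y => g2 y j' k')).
Qed.

Hypothesis g1_unit : forall x, g1 x \in unitmx.
Hypothesis g2_unit : forall x, g2 x \in unitmx.

Lemma invmx_prod x : invmx (prod_metric x) =
  block_mx (invmx (g1 (lsubmx x))) 0 0 (invmx (g2 (rsubmx x))).
Proof.
rewrite invmx_block_diag // /prod_metric unitmxE det_ublock unitrM -!unitmxE.
by rewrite g1_unit g2_unit.
Qed.

Lemma christoffel_prod k i j :
  christoffel prod_metric k i j = split3 (christoffel g1) (christoffel g2) k i j.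
Proof.
apply/funext => x; rewrite /split3 /christoffel invmx_prod.
under eq_bigr => l _ do rewrite !dmetric_prod.
rewrite big_split_ord /= /split3.
by case: (split_ordP i) => i' iE; case: (split_ordP j) => j' jE;
  case: (split_ordP k) => k' kE; rewrite ?iE ?jE ?kE;
  (under eq_bigr do rewrite ?split_l ?split_r
    ?(block_mxEul, block_mxEur, block_mxEdl, block_mxEdr) ?mxE
    ?(addr0, subr0, mul0r, mulr0));
  (under [X in _ + X]eq_bigr do rewrite ?split_l ?split_r
    ?(block_mxEul, block_mxEur, block_mxEdl, block_mxEdr) ?mxE
    ?(addr0, subr0, mul0r, mulr0));
  rewrite ?big1_eq ?addr0 ?add0r ?mulr0.
Qed.

Lemma riemann_up_prod i j k l x : riemann_up prod_metric i j k l x =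
  split4 (riemann_up g1) (riemann_up g2) i j k l x.
Proof.
rewrite /split4 /riemann_up !christoffel_prod.
under eq_bigr => m _ do rewrite !christoffel_prod.
rewrite big_split_ord /= /split3.
by case: (split_ordP i) => i' iE; case: (split_ordP j) => j' jE;
  case: (split_ordP k) => k' kE; case: (split_ordP l) => l' lE;
  rewrite ?iE ?jE ?kE ?lE ?partialE ?partial_cst;
  (under eq_bigr do rewrite ?split_l ?split_r ?(mul0r, mulr0, subr0));
  (under [X in _ + (_ + X)]eq_bigr do
    rewrite ?split_l ?split_r ?(mul0r, mulr0, subr0));
  rewrite ?big1_eq ?(oppr0, addr0, add0r).
Qed.


Lemma curv_prod_ll k l x : curv prod_metric (lshift n2 k) (lshift n2 l) x =
  block_mx (curv g1 k l (lsubmx x)) 0 0 0.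
Proof.
apply/matrixP => i j; rewrite mxE riemann_up_prod /split4 !split_l.
case: (split_ordP i) => i' ->; case: (split_ordP j) => j' ->;
by rewrite ?(block_mxEul, block_mxEur, block_mxEdl, block_mxEdr) mxE.
Qed.

Lemma curv_prod_rr k l x : curv prod_metric (rshift n1 k) (rshift n1 l) x =
  block_mx 0 0 0 (curv g2 k l (rsubmx x)).
Proof.
apply/matrixP => i j; rewrite mxE riemann_up_prod /split4 !split_r.
case: (split_ordP i) => i' ->; case: (split_ordP j) => j' ->;
by rewrite ?(block_mxEul, block_mxEur, block_mxEdl, block_mxEdr) mxE.
Qed.

Lemma curv_prod_lr k l x : curv prod_metric (lshift n2 k) (rshift n1 l) x = 0.
Proof.
apply/matrixP => i j; rewrite !mxE riemann_up_prod /split4 split_l split_r.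
by case: (fintype.split i) => ?; case: (fintype.split j).
Qed.

Lemma curv_prod_rl k l x : curv prod_metric (rshift n1 k) (lshift n2 l) x = 0.
Proof. by rewrite curv_swap curv_prod_lr oppr0. Qed.

Lemma ricci_mx_prod x : ricci_mx prod_metric x =
  block_mx (ricci_mx g1 (lsubmx x)) 0 0 (ricci_mx g2 (rsubmx x)).
Proof.
apply/matrixP => j l; rewrite mxE /ricci.
under eq_bigr => i _ do rewrite riemann_up_prod.
rewrite big_split_ord /= /split4.
case: (split_ordP j) => j' ->; case: (split_ordP l) => l' ->;
rewrite ?(block_mxEul, block_mxEur, block_mxEdl, block_mxEdr) mxE /ricci;
(under eq_bigr do rewrite split_l);
(under [X in _ + X]eq_bigr do rewrite split_r);
by rewrite ?big1_eq ?addr0 ?add0r.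
Qed.

Lemma scal_prod x :
  scal prod_metric x = scal g1 (lsubmx x) + scal g2 (rsubmx x).
Proof.
rewrite !scal_tr invmx_prod ricci_mx_prod tr_block_mx mulmx_block mxtrace_block.
by rewrite !trmx0 !mul0mx addr0 add0r.
Qed.

Lemma ricci_mx_norm2_prod x : ricci_mx_norm2 prod_metric x =
  ricci_mx_norm2 g1 (lsubmx x) + ricci_mx_norm2 g2 (rsubmx x).
Proof.
rewrite /ricci_mx_norm2 invmx_prod ricci_mx_prod tr_block_mx !trmx0.
by rewrite !mulmx_block mxtrace_block !(mul0mx, mulmx0, addr0, add0r).
Qed.

(** R(d_k, d_l) vanishes unless k and l belong to the same factor, and then it
    acts on that factor only; the inverse metric pairs k with k' and l with l'
    inside one factor. *)
Lemma curv_norm2_prod x : curv_norm2 prod_metric x =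
  curv_norm2 g1 (lsubmx x) + curv_norm2 g2 (rsubmx x).
Proof.
rewrite /curv_norm2 invmx_prod -mulrDr; congr (_ * _).
rewrite big_split_ord; congr (_ + _); apply: eq_bigr => k _;
  rewrite big_split_ord /=.
- rewrite [X in _ + X]big1 ?addr0 => [|k' _]; last first.
    rewrite big1 // => l _; rewrite big1 // => l' _.
    by rewrite block_mxEur mxE !mul0r.
  apply: eq_bigr => k' _; rewrite big_split_ord /=.
  rewrite [X in _ + X]big1 ?addr0 => [|l _]; last first.
    by rewrite big1 // => l' _; rewrite curv_prod_lr mul0mx mxtrace0 mulr0.
  apply: eq_bigr => l _; rewrite big_split_ord /=.
  rewrite [X in _ + X]big1 ?addr0 => [|l' _]; last first.
    by rewrite curv_prod_lr mulmx0 mxtrace0 mulr0.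
  apply: eq_bigr => l' _.
  rewrite !curv_prod_ll mulmx_block mxtrace_block !block_mxEul.
  by rewrite !(mul0mx, mulmx0, addr0) mxtrace0 addr0.
- rewrite [X in X + _]big1 ?add0r => [|k' _]; last first.
    rewrite big1 // => l _; rewrite big1 // => l' _.
    by rewrite block_mxEdl mxE !mul0r.
  apply: eq_bigr => k' _; rewrite big_split_ord /=.
  rewrite [X in X + _]big1 ?add0r => [|l _]; last first.
    by rewrite big1 // => l' _; rewrite curv_prod_rl mul0mx mxtrace0 mulr0.
  apply: eq_bigr => l _; rewrite big_split_ord /=.
  rewrite [X in X + _]big1 ?add0r => [|l' _]; last first.
    by rewrite curv_prod_rl mulmx0 mxtrace0 mulr0.
  apply: eq_bigr => l' _.
  rewrite !curv_prod_rr mulmx_block mxtrace_block !block_mxEdr.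
  by rewrite !(mul0mx, mulmx0, add0r) mxtrace0 add0r.
Qed.

(** The cross term is the one of (Scal1 + Scal2)^2 / 4. *)
Lemma gauss_bonnet_prod x : gauss_bonnet prod_metric x =
  gauss_bonnet g1 (lsubmx x) + gauss_bonnet g2 (rsubmx x) +
  2^-1 * (scal g1 (lsubmx x) * scal g2 (rsubmx x)).
Proof.
by rewrite /gauss_bonnet curv_norm2_prod ricci_mx_norm2_prod scal_prod; field.
Qed.

Lemma skew_curv_prod x : skew_curv g1 (lsubmx x) -> skew_curv g2 (rsubmx x) ->
  skew_curv prod_metric x.
Proof.
move=> s1 s2 k l; case: (split_ordP k) => k' ->; case: (split_ordP l) => l' ->;
rewrite ?(curv_prod_ll, curv_prod_lr, curv_prod_rl, curv_prod_rr) /prod_metric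
  ?mulmx0 ?trmx0 ?oppr0 // mulmx_block !(mul0mx, mulmx0, addr0, add0r) tr_block_mx
  opp_block_mx ?trmx0 ?oppr0.
- by rewrite s1.
- by rewrite s2.
Qed.

End Product.

Section TorusProduct.
Variable R : realType.

Lemma posdef_unitmx n (G : 'M[R]_n) : positive_definite G -> G \in unitmx.
Proof.
move=> Gpos; rewrite -row_free_unit -kermx_eq0; apply: contraT => K0.
have v0 := nz_row_eq0 (kermx G); have v0' : nz_row (kermx G) != 0 by rewrite v0.
have := Gpos _ v0'.
have /sub_kermxP -> := nz_row_sub (kermx G).
by rewrite mul0mx mxE ltxx.
Qed.

Lemma torus_metric_prod n1 n2 (g1 : 'rV[R]_n1 -> 'M[R]_n1)
    (g2 : 'rV[R]_n2 -> 'M[R]_n2) :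
  torus_metric g1 -> torus_metric g2 -> torus_metric (prod_metric g1 g2).
Proof.
move=> t1 t2; split.
- move=> i j; rewrite (funext (prod_metricE g1 g2 i j)).
  case: (fintype.split i) => i'; case: (fintype.split j) => j'.
  + apply: (smooth_comp_linear (f := fun y => g1 y i' j')).
    * exact: linearP.
    * exact: continuous_lsubmx.
    * move=> k; case: (split_ordP k) => k' ->; [right; exists k'|left];
        by rewrite /= ?lsubmx_e_l ?lsubmx_e_r.
    * exact: metric_smooth.
  + by move=> k; exact: classC_cst.
  + by move=> k; exact: classC_cst.
  + apply: (smooth_comp_linear (f := fun y => g2 y i' j')).
    * exact: linearP.
    * exact: continuous_rsubmx.
    * move=> k; case: (split_ordP k) => k' ->; [left|right; exists k'];
        by rewrite /= ?rsubmx_e_l ?rsubmx_e_r.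
    * exact: metric_smooth.
- move=> x z; rewrite /prod_metric !linearD /= -map_lsubmx -map_rsubmx.
  by rewrite (metric_periodic t1) (metric_periodic t2).
- by move=> x; rewrite tr_block_mx (Defs.metric_sym t1) (Defs.metric_sym t2) !trmx0.
- move=> x v v0; rewrite -[v]hsubmxK /prod_metric mul_row_block tr_row_mx.
  rewrite mul_row_col !mulmx0 addr0 add0r mxE.
  have nneg n (G : 'M[R]_n) (u : 'rV_n) :
      positive_definite G -> 0 <= (u *m G *m u^T) 0 0.
    by move=> Gp; have [->|/Gp/ltW//] := eqVneq u 0; rewrite !mul0mx mxE.
  have [l0|l0] := eqVneq (lsubmx v) 0; last first.
    by apply: ltr_wpDr; [apply/nneg/(metric_posdef t2)|exact: (metric_posdef t1)].
  apply: ltr_wpDl; first exact/nneg/(metric_posdef t1).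
  apply: (metric_posdef t2); apply: contraNneq v0 => r0.
  by rewrite -[v]hsubmxK l0 r0 row_mx0.
Qed.

End TorusProduct.

(** * Trigonometric polynomials of degree one *)

Section Trig.
Set Implicit Arguments.
Unset Strict Implicit.
Variable R : realType.

Definition two_pi : R := pi *+ 2.

Local Notation w := two_pi.

Definition trig n (a b c : R) (x : 'rV[R]_n.+1) : R :=
  a + b * cos (w * x 0 0) + c * sin (w * x 0 0).

Lemma periodicz (f : R -> R) (T : R) : periodic f T ->
  forall (z : int) a, f (a + T * z%:~R) = f a.
Proof.
move=> fT [m|m] a; first by rewrite -pmulrn mulr_natr periodicn.
by rewrite NegzE mulrNz mulrN -pmulrn mulr_natr -{2}(subrK (T *+ m.+1) a) periodicn.
Qed.

Lemma trig_periodic n a b c (x : 'rV[R]_n.+1) (z : 'rV[int]_n.+1) :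
  trig a b c (x + map_mx intr z) = trig a b c x.
Proof.
rewrite /trig !mxE mulrDr (periodicz (@cosD2pi R)).
by rewrite (periodicz (@sinD2pi R)).
Qed.

Let F a b c (t : R) : R := a + b * cos (w * t) + c * sin (w * t).

Let is_derive_comb (f g : R -> R) t df dg a b c :
  is_derive t (1 : R) f df -> is_derive t (1 : R) g dg ->
  is_derive t (1 : R) (fun s => a + b * f s + c * g s) (0 + b * df + c * dg).
Proof.
move=> df1 dg1.
exact: (is_deriveD (is_deriveD (is_derive_cst a t 1) (is_deriveZ b df1))
  (is_deriveZ c dg1)).
Qed.

Let F_derive a b c t : is_derive t (1 : R) (F a b c) (F 0 (w * c) (- (w * b)) t).
Proof.
have d : is_derive t (1 : R) (fun s => w * s) w.
  have := @is_deriveZ _ _ _ id w t 1 1 (is_derive_id _ _).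
  by rewrite [w *: 1]mulr1.
have -> : F 0 (w * c) (- (w * b)) t =
    0 + b * (- sin (w * t) * w) + c * (cos (w * t) * w) by rewrite /F; ring.
have dcos := @is_derive1_comp _ (@cos R) (fun s => w * s) t _ _
  (is_derive_cos _) d.
have dsin := @is_derive1_comp _ (@sin R) (fun s => w * s) t _ _
  (is_derive_sin _) d.
exact: (is_derive_comb a b c dcos dsin).
Qed.

Let coord_lin n : linear (fun y : 'rV[R]_n.+1 => y 0 0 : R^o).
Proof. by move=> a u v; rewrite !mxE. Qed.

Lemma partial_trig n (i : 'I_n.+1) a b c (x : 'rV[R]_n.+1) :
  partial i (trig a b c) x = if i == 0 then trig 0 (w * c) (- (w * b)) x else 0.
Proof.
rewrite /partial (derive_comp_linear (@coord_lin n) (F a b c)) mxE eqxx /= eq_sym.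
case: eqP => _; last exact: derive0.
by have [_ ->] := F_derive a b c (x 0 0).
Qed.

Lemma trig_derivable n (i : 'I_n.+1) a b c x :
  derivable (trig (n := n) a b c) x 'e_i.
Proof.
apply: (derivable_comp_linear (@coord_lin n) (f := F a b c)).
rewrite mxE eqxx /= eq_sym; case: eqP => _; last exact: derivable0.
by have [] := F_derive a b c (x 0 0).
Qed.

Lemma trig_continuous n a b c : continuous (trig (n := n) a b c).
Proof.
move=> x; apply: (@continuous_comp _ _ _ (fun y : 'rV[R]_n.+1 => y 0 0) (F a b c)).
  exact: coord_continuous.
apply/differentiable_continuous/derivable1_diffP.
by have [] := F_derive a b c (x 0 0).
Qed.

Lemma trig_smooth n a b c : smooth (trig (n := n) a b c).
Proof.
move=> k; elim: k a b c => [|k IHk] a b c; split=> //; try exact: trig_continuous.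
move=> i; split=> [x|]; first exact: trig_derivable.
rewrite (funext (partial_trig i a b c)).
by case: eqP => _; [exact: IHk|exact: classC_cst].
Qed.

End Trig.

(** * Flat tori *)

Section Flat.
Set Implicit Arguments.
Unset Strict Implicit.
Variables (R : realType) (m : nat).

Definition flat_metric (_ : 'rV[R]_m) : 'M[R]_m := 1%:M.

Lemma torus_metric_flat : torus_metric flat_metric.
Proof.
split=> //.
- by move=> i j k; exact: classC_cst.
- by move=> x; rewrite trmx1.
move=> x v v0; rewrite mulmx1 mxE.
under eq_bigr => i _ do rewrite mxE -expr2.
rewrite lt_def sumr_ge0 => [|i _]; last exact: sqr_ge0.
rewrite andbT; apply: contraNneq v0 => v0.
apply/eqP/rowP => i; rewrite mxE; apply/eqP; rewrite -sqrf_eq0; apply/eqP.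
exact: (psumr_eq0P (fun i _ => sqr_ge0 (v 0 i)) v0).
Qed.

Lemma curv_flat k l x : curv flat_metric k l x = 0.
Proof.
have chr0 i j p : christoffel flat_metric i j p = fun=> 0.
  apply/funext => y; rewrite /christoffel big1 ?mulr0 // => q _.
  by rewrite /dmetric /flat_metric !partial_cst addr0 subr0 mulr0.
apply/matrixP => i j; rewrite !mxE /riemann_up !chr0 !partial_cst subr0 add0r.
by rewrite big1 // => p _; rewrite !chr0 mulr0 subr0.
Qed.

Lemma ricci_mx_flat x : ricci_mx flat_metric x = 0.
Proof.
apply/matrixP => j l; rewrite !mxE /ricci big1 // => i _.
by have /matrixP/(_ i j) := curv_flat i l x; rewrite !mxE.
Qed.

Lemma scal_flat x : scal flat_metric x = 0.
Proof. by rewrite scal_tr ricci_mx_flat trmx0 mulmx0 mxtrace0. Qed.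

Lemma gauss_bonnet_flat x : gauss_bonnet flat_metric x = 0.
Proof.
rewrite /gauss_bonnet scal_flat /ricci_mx_norm2 ricci_mx_flat.
rewrite mulmx0 mul0mx mxtrace0 expr0n mulr0 addr0 subr0 /curv_norm2 big1 ?mulr0 // => k _.
rewrite big1 // => k' _; rewrite big1 // => l _; rewrite big1 // => l' _.
by rewrite curv_flat mul0mx mxtrace0 mulr0.
Qed.

End Flat.

(** * A metric of constant negative scalar curvature on the 3-torus *)

Section Twisted.
Set Implicit Arguments.
Unset Strict Implicit.
Variable R : realType.
Local Notation w := (two_pi R).

(** The metric dt^2 + G(t), with G = 5/4 + 3/4 S; its inverse replaces G by
    5/4 - 3/4 S, since S^2 = 1 and (5/4)^2 - (3/4)^2 = 1.  Index 0 is the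
    coordinate t.  Below, T is S'/w and J = S T = [[0, 1], [-1, 0]]. *)
Definition twisted_entry (i j : nat) : 'rV[R]_3 -> R :=
  match i, j with
  | 0, 0 => trig 1 0 0
  | 1, 1 => trig (5 / 4) (3 / 4) 0
  | 1, 2 | 2, 1 => trig 0 0 (3 / 4)
  | 2, 2 => trig (5 / 4) (- (3 / 4)) 0
  | _, _ => trig 0 0 0
  end%N.

Definition twisted (x : 'rV[R]_3) : 'M[R]_3 := \matrix_(i, j) twisted_entry i j x.

Definition twisted_inv_entry (i j : nat) : 'rV[R]_3 -> R :=
  match i, j with
  | 0, 0 => trig 1 0 0
  | 1, 1 => trig (5 / 4) (- (3 / 4)) 0
  | 1, 2 | 2, 1 => trig 0 0 (- (3 / 4))
  | 2, 2 => trig (5 / 4) (3 / 4) 0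
  | _, _ => trig 0 0 0
  end%N.

Definition twisted_deriv (l i j : nat) : 'rV[R]_3 -> R :=
  match l, i, j with
  | 0, 1, 1 => trig 0 0 (- (3 / 4))
  | 0, 1, 2 | 0, 2, 1 => trig 0 (3 / 4) 0
  | 0, 2, 2 => trig 0 0 (3 / 4)
  | _, _, _ => trig 0 0 0
  end%N.

(** Gamma^0 restricted to the slices is - G'/2 = - 3/8 w T, and
    Gamma^i_{0j} = A^i_j with A = G^-1 G' / 2 = w (15/32 T - 9/32 J). *)
Definition twisted_christoffel (k i j : nat) : 'rV[R]_3 -> R :=
  match k, i, j with
  | 0, 1, 1 => trig 0 0 (3 / 8 * w)
  | 0, 1, 2 | 0, 2, 1 => trig 0 (- (3 / 8 * w)) 0
  | 0, 2, 2 => trig 0 0 (- (3 / 8 * w))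
  | 1, 0, 1 | 1, 1, 0 => trig 0 0 (- (15 / 32 * w))
  | 1, 0, 2 | 1, 2, 0 => trig (- (9 / 32 * w)) (15 / 32 * w) 0
  | 2, 0, 1 | 2, 1, 0 => trig (9 / 32 * w) (15 / 32 * w) 0
  | 2, 0, 2 | 2, 2, 0 => trig 0 0 (15 / 32 * w)
  | _, _, _ => trig 0 0 0
  end%N.

(** The matrices of R(d_k, d_l) / w^2 for k < l, indexed by p = k + l, which
    tells the pairs 01, 02, 12 apart.  For j = 1, 2, R(d_0, d_j) sends d_i to
    B_ij d_0 and d_0 to - sum_i (G^-1 B)_ij d_i, where B = 45/256 + 123/256 S
    and G^-1 B = 15/32 S - 9/64; R(d_1, d_2) is 9/64 G^-1 J on the slices. *)
Definition twisted_curv (p i j : nat) : 'rV[R]_3 -> R :=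
  match p, i, j with
  | 1, 0, 1 => trig (45 / 256) (123 / 256) 0
  | 1, 0, 2 => trig 0 0 (123 / 256)
  | 1, 1, 0 => trig (9 / 64) (- (15 / 32)) 0
  | 1, 2, 0 => trig 0 0 (- (15 / 32))
  | 2, 0, 1 => trig 0 0 (123 / 256)
  | 2, 0, 2 => trig (45 / 256) (- (123 / 256)) 0
  | 2, 1, 0 => trig 0 0 (- (15 / 32))
  | 2, 2, 0 => trig (9 / 64) (15 / 32) 0
  | 3, 1, 1 => trig 0 0 (27 / 256)
  | 3, 1, 2 => trig (45 / 256) (- (27 / 256)) 0
  | 3, 2, 1 => trig (- (45 / 256)) (- (27 / 256)) 0
  | 3, 2, 2 => trig 0 0 (- (27 / 256))
  | _, _, _ => trig 0 0 0
  end%N.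

(** The sign is zero when k = l, so that the ambiguity between the pairs 02 and
    11, which have the same sum, is harmless. *)
Definition pair_sign (k l : nat) : R :=
  if (k < l)%N then 1 else if (l < k)%N then -1 else 0.

(** The Ricci tensor divided by w^2: - 9/32 dt^2 + 15/32 G S. *)
Definition twisted_ricci (i j : nat) : 'rV[R]_3 -> R :=
  match i, j with
  | 0, 0 => trig (- (9 / 32)) 0 0
  | 1, 1 => trig (45 / 128) (75 / 128) 0
  | 1, 2 | 2, 1 => trig 0 0 (75 / 128)
  | 2, 2 => trig (45 / 128) (- (75 / 128)) 0
  | _, _ => trig 0 0 0
  end%N.

(** The traces of products of the matrices in [twisted_curv]. *)
Definition twisted_trace (p q : nat) : 'rV[R]_3 -> R :=
  match p, q with
  | 1, 1 => trig (- (3285 / 8192)) (- (243 / 8192)) 0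
  | 1, 2 | 2, 1 => trig 0 0 (- (243 / 8192))
  | 2, 2 => trig (- (3285 / 8192)) (243 / 8192) 0
  | 3, 3 => trig (- (81 / 2048)) 0 0
  | _, _ => trig 0 0 0
  end%N.

(** The sum over l, l' of g^{ll'} tr (R(d_k, d_l) R(d_k', d_l')), divided by w^4:
    - 981/1024 for k = k' = 0, and - 1845/4096 - 243/4096 S on the slices. *)
Definition twisted_contracted_trace (k k' : nat) : 'rV[R]_3 -> R :=
  match k, k' with
  | 0, 0 => trig (- (981 / 1024)) 0 0
  | 1, 1 => trig (- (1845 / 4096)) (- (243 / 4096)) 0
  | 1, 2 | 2, 1 => trig 0 0 (- (243 / 4096))
  | 2, 2 => trig (- (1845 / 4096)) (243 / 4096) 0
  | _, _ => trig 0 0 0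
  end%N.

Lemma sum3 (f : nat -> R) : \sum_(i < 3) f i = f 0%N + f 1%N + f 2%N.
Proof. by rewrite !big_ord_recr big_ord0 /= add0r. Qed.

Lemma torus_metric_twisted : torus_metric twisted.
Proof.
split.
- move=> i j; have -> : (fun x => twisted x i j) = twisted_entry i j.
    by apply/funext => x; rewrite mxE.
  by case: i => [[|[|[|//]]] i]; case: j => [[|[|[|//]]] j];
    exact: trig_smooth.
- move=> x z; apply/matrixP => i j; rewrite !mxE.
  by case: i => [[|[|[|//]]] i]; case: j => [[|[|[|//]]] j];
    exact: trig_periodic.
- move=> x; apply/matrixP => i j; rewrite !mxE.
  by case: i => [[|[|[|//]]] i]; case: j => [[|[|[|//]]] j].
move=> x v v0.
have cs := cos2sin2 (w * x 0 0).
set c := cos _ in cs; set s := sin _ in cs.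
pose v0' := v 0 0; pose v1 := v 0 1; pose v2 := v 0 2%:R.
(* G = 1/2 + 3/4 (1 + S), and (1 + S)^2 = 2 (1 + S) exhibits 1 + S as a sum of
   squares. *)
have -> : (v *m twisted x *m v^T) 0 0 =
    v0' ^+ 2 + (v1 ^+ 2 + v2 ^+ 2) / 2 +
    3 / 8 * (((1 + c) * v1 + s * v2) ^+ 2 + (s * v1 + (1 - c) * v2) ^+ 2).
  rewrite mxE !big_ord_recr big_ord0 /= !mxE !big_ord_recr !big_ord0 /= !mxE /=.
  rewrite /trig -/c -/s.
  have -> : widen_ord (leqnSn 2) (widen_ord (leqnSn 1) (ord_max : 'I_1)) = 0
    by exact: val_inj.
  have -> : widen_ord (leqnSn 2) (ord_max : 'I_2) = 1 by exact: val_inj.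
  have -> : (ord_max : 'I_3) = 2%:R by exact: val_inj.
  by rewrite -/v0' -/v1 -/v2; field: cs.
have pos (a b d : R) : 0 <= 3 / 8 * (a ^+ 2 + b ^+ 2).
  by rewrite mulr_ge0 ?divr_ge0 ?ler0n // addr_ge0 ?sqr_ge0.
apply: ltr_wpDr; first exact: pos.
rewrite lt_def addr_ge0 ?divr_ge0 ?addr_ge0 ?sqr_ge0 ?ler0n // andbT.
apply: contraNneq v0 => q0.
have [q1 q2 q3] := And3 (sqr_ge0 v0') (sqr_ge0 v1) (sqr_ge0 v2).
apply/eqP/rowP => i; rewrite mxE; apply/eqP; rewrite -sqrf_eq0; apply/eqP.
case: i => [[|[|[|//]]] i].
- by rewrite (_ : Ordinal i = 0); [rewrite -/v0'; lra|exact: val_inj].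
- by rewrite (_ : Ordinal i = 1); [rewrite -/v1; lra|exact: val_inj].
- by rewrite (_ : Ordinal i = 2%:R); [rewrite -/v2; lra|exact: val_inj].
Qed.

Lemma mul_twisted_inv x :
  twisted x *m \matrix_(i, j) twisted_inv_entry i j x = 1%:M.
Proof.
apply/matrixP => i j; rewrite !mxE !big_ord_recr big_ord0 /= !mxE.
have cs := cos2sin2 (w * x 0 0).
by case: i => [[|[|[|//]]] i]; case: j => [[|[|[|//]]] j];
  rewrite /twisted_entry /twisted_inv_entry /= /trig; field: cs.
Qed.

Lemma invmx_twisted x : invmx (twisted x) = \matrix_(i, j) twisted_inv_entry i j x.
Proof.
have gu := mul_twisted_inv x; have [g_unit _] := mulmx1_unit gu.
by rewrite -[RHS](mulKmx g_unit) gu mulmx1.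
Qed.

Lemma dmetric_twisted l i j x : dmetric twisted l i j x = w * twisted_deriv l i j x.
Proof.
have -> : dmetric twisted l i j x = partial l (twisted_entry i j) x.
  by congr (partial l _ x); apply/funext => y; rewrite mxE.
by case: i => [[|[|[|//]]] i]; case: j => [[|[|[|//]]] j];
  rewrite /twisted_entry partial_trig; case: l => [[|[|[|//]]] l];
  rewrite /twisted_deriv /= /trig; ring.
Qed.

Lemma christoffel_twisted k i j :
  christoffel twisted k i j = twisted_christoffel k i j.
Proof.
apply/funext => x; rewrite /christoffel invmx_twisted !big_ord_recr big_ord0 /=.
rewrite !dmetric_twisted !mxE /=.
have cs := cos2sin2 (w * x 0 0).
by case: k => [[|[|[|//]]] k]; case: i => [[|[|[|//]]] i];
  case: j => [[|[|[|//]]] j];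
  rewrite /twisted_deriv /twisted_inv_entry /twisted_christoffel /= /trig; field: cs.
Qed.

(** Each entry is an identity between polynomials in cos wt and sin wt, modulo
    cos^2 + sin^2 = 1. *)
Lemma riemann_up_twisted i j k l x : riemann_up twisted i j k l x =
  pair_sign k l * w ^+ 2 * twisted_curv (k + l) i j x.
Proof.
rewrite /riemann_up !christoffel_twisted !big_ord_recr big_ord0 /=.
rewrite !christoffel_twisted /=.
have cs := cos2sin2 (w * x 0 0).
by case: k => [[|[|[|//]]] k]; case: l => [[|[|[|//]]] l];
  case: i => [[|[|[|//]]] i]; case: j => [[|[|[|//]]] j];
  rewrite /twisted_christoffel !partial_trig /= /pair_sign /twisted_curv /=
    /trig; field: cs.
Qed.

Let curv_mx p x : 'M[R]_3 := \matrix_(i, j) twisted_curv p i j x.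

Lemma curv_twisted k l x :
  curv twisted k l x = (pair_sign k l * w ^+ 2) *: curv_mx (k + l) x.
Proof. by apply/matrixP => i j; rewrite !mxE riemann_up_twisted. Qed.

Lemma skew_curv_twisted x : skew_curv twisted x.
Proof.
move=> k l; rewrite curv_twisted -scalemxAr linearZ -scalerN /=; congr (_ *: _).
move: (k + l)%N => p; apply/matrixP => i j.
rewrite !mxE !big_ord_recr !big_ord0 /= !mxE /=.
have cs := cos2sin2 (w * x 0 0).
by case: p => [|[|[|[|p]]]];
  case: i => [[|[|[|//]]] i]; case: j => [[|[|[|//]]] j];
  rewrite /twisted_entry /twisted_curv /= /trig; field: cs.
Qed.

Lemma ricci_mx_twisted x :
  ricci_mx twisted x = w ^+ 2 *: \matrix_(i, j) twisted_ricci i j x.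
Proof.
apply/matrixP => i j; rewrite !mxE /ricci !big_ord_recr big_ord0 /=.
rewrite !riemann_up_twisted /=.
by case: i => [[|[|[|//]]] i]; case: j => [[|[|[|//]]] j];
  rewrite /twisted_ricci /pair_sign /twisted_curv /= /trig; field.
Qed.

Lemma scal_twisted x : scal twisted x = - (9 / 32 * w ^+ 2).
Proof.
rewrite scal_tr invmx_twisted ricci_mx_twisted /mxtrace.
rewrite !big_ord_recr big_ord0 /= !mxE.
rewrite !big_ord_recr !big_ord0 /= !mxE /= /trig.
have cs := cos2sin2 (w * x 0 0).
by field: cs.
Qed.

Lemma ricci_mx_norm2_twisted x : ricci_mx_norm2 twisted x = 531 / 1024 * w ^+ 4.
Proof.
rewrite /ricci_mx_norm2 invmx_twisted ricci_mx_twisted [(_ *: _)^T]linearZ /=.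
rewrite -!scalemxAr -scalemxAl !mxtraceZ.
rewrite /mxtrace; repeat rewrite ?mxE !big_ord_recr !big_ord0 /=.
rewrite !mxE /= /trig.
have cs := cos2sin2 (w * x 0 0).
by field: cs.
Qed.

Lemma trace_curv_mx p q x : \tr (curv_mx p x *m curv_mx q x) = twisted_trace p q x.
Proof.
rewrite /mxtrace !big_ord_recr big_ord0 /= !mxE.
rewrite !big_ord_recr !big_ord0 /= !mxE /=.
have cs := cos2sin2 (w * x 0 0).
by case: p => [|[|[|[|p]]]]; case: q => [|[|[|[|q]]]];
  rewrite /twisted_trace /twisted_curv /= /trig; field: cs.
Qed.

Lemma trace_curv_twisted k l k' l' x :
  \tr (curv twisted k l x *m curv twisted k' l' x) =
  pair_sign k l * pair_sign k' l' * w ^+ 4 * twisted_trace (k + l) (k' + l') x.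
Proof.
by rewrite !curv_twisted -scalemxAr -scalemxAl !mxtraceZ trace_curv_mx; ring.
Qed.

Lemma contracted_trace_twisted k k' x :
  \sum_l \sum_l' invmx (twisted x) l l' * \tr (curv twisted k l x *m curv twisted k' l' x) =
  w ^+ 4 * twisted_contracted_trace k k' x.
Proof.
pose F (l l' : nat) : R := twisted_inv_entry l l' x *
  (pair_sign k l * pair_sign k' l' * w ^+ 4 * twisted_trace (k + l) (k' + l') x).
rewrite invmx_twisted; under eq_bigr => l _ do
  (under eq_bigr => l' _ do rewrite trace_curv_twisted mxE -/(F l l')).
rewrite (sum3 (fun l => \sum_(l' < 3) F l l')) !(fun l => sum3 (F l)) /F {F}.
have cs := cos2sin2 (w * x 0 0).
by case: k => [[|[|[|//]]] k]; case: k' => [[|[|[|//]]] k'];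
  rewrite /twisted_inv_entry /pair_sign /twisted_trace /twisted_contracted_trace /= /trig;
  field: cs.
Qed.

Lemma curv_norm2_twisted x : curv_norm2 twisted x = 2043 / 4096 * w ^+ 4.
Proof.
rewrite /curv_norm2.
under eq_bigr => k _ do under eq_bigr => k' _ do
  (under eq_bigr => l _ do
    (under eq_bigr => l' _ do rewrite -mulrA; rewrite -mulr_sumr);
  rewrite -mulr_sumr contracted_trace_twisted invmx_twisted mxE).
pose F (k k' : nat) : R :=
  twisted_inv_entry k k' x * (w ^+ 4 * twisted_contracted_trace k k' x).
rewrite (sum3 (fun k => \sum_(k' < 3) F k k')) !(fun k => sum3 (F k)) /F {F}.
rewrite /twisted_inv_entry /twisted_contracted_trace /= /trig.
have cs := cos2sin2 (w * x 0 0).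
by field: cs.
Qed.

(** 2043/4096 - 531/1024 + (9/32)^2 / 4 = 0. *)
Lemma gauss_bonnet_twisted x : gauss_bonnet twisted x = 0.
Proof.
rewrite /gauss_bonnet curv_norm2_twisted ricci_mx_norm2_twisted scal_twisted.
by field.
Qed.

End Twisted.

(** * The theorem *)

Theorem mainTheorem5 (R : realType) (n : nat) (hn : (6 <= n)%N) :
  exists g : 'rV[R]_n -> 'M[R]_n,
    torus_metric g /\
    exists c : R,
      0 < c /\
      forall (x : 'rV[R]_n) (e : 'M[R]_n), orthonormal_basis g x e -> h4 g x e = c.
Proof.
have [m ->] : exists m, n = (3 + (3 + m))%N.
  by exists (n - 6)%N; rewrite addnA subnKC.
have t3 := torus_metric_twisted R; have t0 := torus_metric_flat R m.
pose g' := prod_metric (@twisted R) (@flat_metric R m).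
have t' : torus_metric g' by exact: torus_metric_prod.
have unit3 x := posdef_unitmx (metric_posdef t3 x).
have unit0 x := posdef_unitmx (metric_posdef t0 x).
have unit' x := posdef_unitmx (metric_posdef t' x).
exists (prod_metric (@twisted R) g'); split; first exact: torus_metric_prod.
exists (2^-1 * (9 / 32 * two_pi R ^+ 2) ^+ 2); split.
  rewrite mulr_gt0 ?invr_gt0 ?ltr0n // exprn_gt0 // mulr_gt0 ?divr_gt0 ?ltr0n //.
  by rewrite exprn_gt0 // mulrn_wgt0 // pi_gt0.
move=> x e eo; rewrite h4_gauss_bonnet //; last first.
  apply: skew_curv_prod => //; first exact: skew_curv_twisted.
  apply: skew_curv_prod => //; first exact: skew_curv_twisted.
  by move=> k l; rewrite curv_flat mulmx0 trmx0 oppr0.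
rewrite gauss_bonnet_prod // gauss_bonnet_prod // scal_prod //.
rewrite !gauss_bonnet_twisted gauss_bonnet_flat !scal_twisted scal_flat.
by ring.
Qed.
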